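(* There is no non-trivial perfect code $C$ in any generalised quadrangle such that $\operatorname{Aut}(C)$ contains a subgroup acting transitively on $C$.
   Context: A generalised quadrangle of order $(s,t)$, $s,t\geq 1$ finite, is a point-line incidence structure in which: each point is incident with $t+1$ lines and two distinct points are incident with at most one common line; each line is incident with $s+1$ points and two distinct lines are incident with at most one common point; and for each point $p$ and line $L$ not incident with $p$ there is a unique pair $(r,M)$ of a point $r$ and a line $M$ such that $p$ is on $M$, $r$ is on $M$ and $r$ is on $L$. Let $\varGamma$ be its point-line incidence graph (vertices: all points and lines; adjacency: incidence). A code $C$ is a subset of the vertex set of $\varGamma$. The minimum distance $\delta$ is the smallest graph distance between two distinct elements of $C$; $C_i$ is the set of vertices whose distance to a nearest element of $C$ is exactly $i$; the covering radius $\rho$ is the maximum $i$ with $C_i\neq\emptyset$ (with $C_0=C$). $\operatorname{Aut}(C)$ is the setwise stabiliser of $C$ in the graph automorphism group $\operatorname{Aut}(\varGamma)$. A code is trivial if $|C|\leq 1$ or $C$ is the entire vertex set of $\varGamma$. A code is perfect if $\rho=\lfloor(\delta-1)/2\rfloor$; equivalently, the balls of radius $\rho$ centred at the codewords partition the vertex set of $\varGamma$. *)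

(* Defs.v *)
From mathcomp Require Import all_boot all_fingroup.

Set Implicit Arguments.
Unset Strict Implicit.
Unset Printing Implicit Defensive.

Record gen_quadrangle (P L : finType) (s t : nat) (I : P -> L -> bool) : Prop :=
  GenQuadrangle {
    gq_s_gt0 : 0 < s;
    gq_t_gt0 : 0 < t;
    gq_point_degree : forall p : P, #|[set l : L | I p l]| = t.+1;
    gq_point_pair : forall p q : P,
      p != q -> #|[set l : L | I p l && I q l]| <= 1;
    gq_line_degree : forall l : L, #|[set p : P | I p l]| = s.+1;
    gq_line_pair : forall l m : L,
      l != m -> #|[set p : P | I p l && I p m]| <= 1;
    gq_projection : forall (p : P) (l : L), ~~ I p l ->
      exists! rm : P * L, [/\ I p rm.2, I rm.1 rm.2 & I rm.1 l]
  }.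

Definition incidence_graph (P L : finType) (I : P -> L -> bool) :
    rel (P + L)%type :=
  fun u v =>
    match u, v with
    | inl p, inr l => I p l
    | inr l, inl p => I p l
    | _, _ => false
    end.

Section Graph.

Variables (V : finType) (e : rel V).
Implicit Types (C : {set V}) (x y v : V).

Definition walk (n : nat) x y : bool :=
  [exists p : n.-tuple V, path e x p && (last x p == y)].

(* The length of a shortest walk.  A shortest walk visits no vertex twice, so
   lengths below #|V| suffice; the value #|V| means that there is no walk. *)
Definition gdist x y : nat := find (fun n => walk n x y) (iota 0 #|V|).

(* In this and the next definition the default #|V| is an upper bound of gdist,
   hence it is only visible when the index set of the minimum is empty. *)
Definition code_dist C v : nat := \big[minn/#|V|]_(c in C) gdist v c.

Definition min_distance C : nat :=
  \big[minn/#|V|]_(u in setX C C | u.1 != u.2) gdist u.1 u.2.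

Definition code_cell C (i : nat) : {set V} := [set v | code_dist C v == i].

Definition covering_radius C : nat :=
  \max_(i < #|V|.+1 | code_cell C i != set0) i.

Definition trivial_code C : bool := (#|C| <= 1) || (C == [set: V]).

Definition perfect_code C : bool :=
  covering_radius C == (min_distance C - 1) %/ 2.

Definition graph_aut : {set {perm V}} :=
  [set g : {perm V} | [forall x, forall y, e (g x) (g y) == e x y]].

Lemma graph_autP (g : {perm V}) :
  reflect (forall x y, e (g x) (g y) = e x y) (g \in graph_aut).
Proof.
rewrite inE; apply: (iffP forallP) => h x; last by apply/forallP=> y; rewrite h.
by move=> y; apply/eqP; have /forallP := h x.
Qed.

Lemma graph_aut_group_set : group_set graph_aut.
Proof.
apply/group_setP; split=> [|g h /graph_autP hg /graph_autP hh].
  by apply/graph_autP=> x y; rewrite !perm1.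
by apply/graph_autP=> x y; rewrite !permM hh hg.
Qed.

Canonical graph_aut_group := Group graph_aut_group_set.

Definition code_aut C : {set {perm V}} := 'N_graph_aut(C | 'P)%g.

Canonical code_aut_group C := [group of code_aut C].

End Graph.

(* Main.v *)
(** A non-trivial perfect code has minimum distance at least 3 and covering
    radius 1: the incidence graph has diameter at most 4, and a code with
    covering radius 0 is trivial.  Hence no two codewords are adjacent or have
    a common neighbour, and every vertex is a codeword or adjacent to one; it
    follows that the code contains both points and lines.  Let b be the number
    of code lines.
    - Around a code point p, each of the s(t+1) points r <> p collinear with p
      lies on a code line; no code line passes through p, so these code lines
      are distinct by the projection axiom, and b >= s(t+1).
    - At a point q of a code line l, each other code line projects to a point
      r <> q on one of the t other lines through q.  These points are distinct
      and are not codewords, but at least one of the ts candidates is, so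
      b - 1 < ts.
    Together, s(t+1) <= ts, which contradicts s >= 1. *)
Require Import Defs.
From mathcomp Require Import all_boot all_fingroup.
From mathcomp Require Import zify.

Set Implicit Arguments.
Unset Strict Implicit.
Unset Printing Implicit Defensive.

(** * Minima over finite families with a default value *)

Section BigMin.

Variables (T : finType) (A : pred T) (F : T -> nat) (d : nat).

Lemma bigminn_le_cond i : A i -> \big[minn/d]_(j | A j) F j <= F i.
Proof.
move=> Ai; rewrite -big_filter.
have: i \in [seq j <- index_enum T | A j] by rewrite mem_filter Ai mem_index_enum.
elim: (filter _ _) => // j r IHr; rewrite in_cons big_cons geq_min.
by case/orP=> [/eqP <-|/IHr ->]; rewrite ?leqnn ?orbT.
Qed.

Lemma bigminn_le_idx : \big[minn/d]_(j | A j) F j <= d.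
Proof.
rewrite -big_filter; elim: (filter _ _) => [|j r IHr]; first by rewrite big_nil.
by rewrite big_cons geq_min IHr orbT.
Qed.

(** As [n < d], the default [d] alone cannot produce the bound, so some term does. *)
Lemma bigminn_attained n : n < d -> \big[minn/d]_(j | A j) F j <= n ->
  exists2 i, A i & F i <= n.
Proof.
move=> nd; have [i /andP[Ai Fi]|noF] := pickP (fun i => A i && (F i <= n)).
  by exists i.
rewrite leqNgt => /negP[]; apply: (big_ind (fun m => n < m)) => // [k m nk nm|j Aj].
  by rewrite leq_min nk.
by have := noF j; rewrite Aj ltnNge /= => ->.
Qed.

End BigMin.

(** * Distances and perfect codes in a graph of diameter at most 4 *)

Section Distance.

Variables (V : finType) (e : rel V).
Implicit Types (C : {set V}) (x y v : V).

Lemma gdist_le_path x p : path e x p -> gdist e x (last x p) <= size p.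
Proof.
(* Otherwise [find] passes over [size p], a length in the searched list at which [p] is a walk. *)
move=> xp; rewrite /gdist leqNgt; apply/negP => lt_p.
have lt_pV: size p < #|V|.
  by apply: leq_trans lt_p _; rewrite -[leqRHS](size_iota 0) find_size.
have : walk e (size p) x (last x p).
  by apply/existsP; exists (in_tuple p); rewrite /= xp eqxx.
by have := before_find 0 lt_p; rewrite nth_iota // add0n => ->.
Qed.

Lemma walk_gdist x y : gdist e x y < #|V| -> walk e (gdist e x y) x y.
Proof.
move=> xyV; have := xyV; rewrite -[X in _ < X](size_iota 0) -has_find.
by move/(nth_find 0); rewrite -/(gdist e x y) nth_iota.
Qed.

Lemma gdist_le0 x y : 0 < #|V| -> gdist e x y <= 0 -> x = y.
Proof.
move=> V0 xy0; have := walk_gdist (leq_ltn_trans xy0 V0).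
by move: xy0; case: (gdist e x y) => // _ /existsP[p]; rewrite tuple0 /= => /eqP.
Qed.

Lemma gdist_le1 x y : 1 < #|V| -> gdist e x y <= 1 -> x = y \/ e x y.
Proof.
move=> V1 xy1; have := walk_gdist (leq_ltn_trans xy1 V1).
case: (gdist e x y) xy1 => [|[|//]] _ /existsP[p].
  by rewrite tuple0 /= => /eqP; left.
case/tupleP: p => z p; rewrite tuple0 /= andbT => /andP[xz /eqP <-].
by right.
Qed.

Lemma min_distance_le C x y :
  x \in C -> y \in C -> x != y -> min_distance e C <= gdist e x y.
Proof.
move=> xC yC xy.
apply: (@bigminn_le_cond _ _ (fun u => gdist e u.1 u.2) _ (x, y)).
by rewrite in_setX xC yC.
Qed.

Lemma code_dist_le_covering_radius C v : code_dist e C v <= covering_radius e C.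
Proof.
(* [code_dist] never exceeds its default [#|V|], so its value is an index of the maximum. *)
have ltV: code_dist e C v < #|V|.+1 by rewrite ltnS; apply: bigminn_le_idx.
apply: (@leq_bigmax_cond _ _ (fun i : 'I__ => i : nat) (Ordinal ltV)).
by apply/set0Pn; exists v; rewrite inE.
Qed.

Lemma covering_radius_le C n v : n < #|V| -> covering_radius e C <= n ->
  exists2 c, c \in C & gdist e v c <= n.
Proof.
move=> nV rn; apply: bigminn_attained nV _.
exact: leq_trans (code_dist_le_covering_radius C v) rn.
Qed.

Lemma perfect_code_diam4 C :
    (forall x y, gdist e x y <= 4) ->
    ~~ trivial_code C -> perfect_code e C ->
  [/\ C != set0,
      forall x y, x \in C -> y \in C -> x != y -> 2 < gdist e x y
    & forall v, v \notin C -> exists2 c, c \in C & e v c].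
Proof.
move=> diam; rewrite /trivial_code negb_or -ltnNge => /andP[C1 CnT] /eqP perfC.
have V1: 1 < #|V| := leq_trans C1 (max_card _).
have d4: min_distance e C <= 4.
  have /card_gt1P[x [y [xC yC xy]]] := C1.
  exact: leq_trans (min_distance_le xC yC xy) (diam x y).
(* The bound 4 on the minimum distance gives [(4 - 1) %/ 2 = 1]. *)
have r1: covering_radius e C <= 1 by rewrite perfC; lia.
split=> [|x y xC yC xy|v vC].
- by rewrite -card_gt0 ltnW.
- apply: leq_trans (min_distance_le xC yC xy).
  (* Minimum distance at most 2 would force covering radius 0, making every vertex a codeword. *)
  rewrite ltnNge; apply: contra CnT => d2.
  have r0: covering_radius e C <= 0 by rewrite perfC; lia.
  rewrite -subTset; apply/subsetP => v _.
  have [c cC vc] := covering_radius_le v (ltnW V1) r0.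
  by rewrite (gdist_le0 (ltnW V1) vc).
- have [c cC /(gdist_le1 V1)[vc|vc]] := covering_radius_le v V1 r1.
    by rewrite vc cC in vC.
  by exists c.
Qed.

End Distance.

(** * Projections and distances in a generalised quadrangle *)

Section GenQuadrangle.

Variables (P L : finType) (s t : nat) (I : P -> L -> bool).
Hypothesis hGQ : gen_quadrangle s t I.
Implicit Types (p q r : P) (l m M : L).

Lemma gq_second_point p l : I p l -> exists2 q, I q l & q != p.
Proof.
move=> pl; have : 0 < #|[set q | I q l] :\ p|.
  have := cardsD1 p [set q | I q l].
  by rewrite inE pl (gq_line_degree hGQ) add1n => -[<-]; apply: gq_s_gt0 hGQ.
by case/card_gt0P => q; rewrite !inE => /andP[qp ql]; exists q.
Qed.

Lemma gq_second_line p l : I p l -> exists2 m, I p m & m != l.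
Proof.
move=> pl; have : 0 < #|[set m | I p m] :\ l|.
  have := cardsD1 l [set m | I p m].
  by rewrite inE pl (gq_point_degree hGQ) add1n => -[<-]; apply: gq_t_gt0 hGQ.
by case/card_gt0P => m; rewrite !inE => /andP[ml pm]; exists m.
Qed.

Lemma gq_line_at p : exists l, I p l.
Proof.
have /card_gt0P[l] : 0 < #|[set l | I p l]| by rewrite (gq_point_degree hGQ).
by rewrite inE; exists l.
Qed.

Lemma gq_point_at l : exists p, I p l.
Proof.
have /card_gt0P[p] : 0 < #|[set p | I p l]| by rewrite (gq_line_degree hGQ).
by rewrite inE; exists p.
Qed.

Lemma gq_projection_fun p : exists f : L -> P * L, forall l, ~~ I p l ->
  [/\ I p (f l).2, I (f l).1 (f l).2, I (f l).1 l
    & forall r M, I p M -> I r M -> I r l -> f l = (r, M)].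
Proof.
pose Q l (u : P * L) := ~~ I p l -> [/\ I p u.2, I u.1 u.2, I u.1 l
  & forall r M, I p M -> I r M -> I r l -> u = (r, M)].
apply: (@fin_all_exists _ (fun=> _) Q) => l; rewrite /Q.
(* Lines through [p] are not projected, so any value serves for them. *)
have [pl|pl] := boolP (I p l); first by exists (p, l).
have [u [[pu uu ul] uniq_u]] := gq_projection hGQ pl.
by exists u => _; split=> // r M pM rM rl; apply: uniq_u.
Qed.

(** A point and a line are joined by one edge or, via the projection, by three; two vertices of the
    same kind need one more edge. *)
Lemma incidence_gdist_le4 x y : gdist (incidence_graph I) x y <= 4.
Proof.
have dist w : path (incidence_graph I) x w -> last x w = y -> size w <= 4 ->
    gdist (incidence_graph I) x y <= 4.
  by move=> xw <-; apply: leq_trans; apply: gdist_le_path.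
case: x y dist => [p|l] [q|m] dist.
- have [l pl] := gq_line_at p; have [ql|ql] := boolP (I q l).
    by apply: (dist [:: inr l; inl q]); rewrite //= pl ql.
  have [[r M] [[/= qM rM rl] _]] := gq_projection hGQ ql.
  by apply: (dist [:: inr l; inl r; inr M; inl q]); rewrite //= pl rl rM qM.
- have [pm|pm] := boolP (I p m).
    by apply: (dist [:: inr m]); rewrite //= pm.
  have [[r M] [[/= pM rM rm] _]] := gq_projection hGQ pm.
  by apply: (dist [:: inr M; inl r; inr m]); rewrite //= pM rM rm.
- have [ql|ql] := boolP (I q l).
    by apply: (dist [:: inl q]); rewrite //= ql.
  have [[r M] [[/= qM rM rl] _]] := gq_projection hGQ ql.
  by apply: (dist [:: inl r; inr M; inl q]); rewrite //= qM rM rl.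
- have [p pl] := gq_point_at l; have [pm|pm] := boolP (I p m).
    by apply: (dist [:: inl p; inr m]); rewrite //= pl pm.
  have [[r M] [[/= pM rM rm] _]] := gq_projection hGQ pm.
  by apply: (dist [:: inl p; inr M; inl r; inr m]); rewrite //= pl pM rM rm.
Qed.

(** These flags are the possible projections from [p]; each line of [D] has [s] points besides
    [p]. *)
Lemma card_flags_off p (D : {set L}) : {in D, forall M, I p M} ->
  #|[set u : P * L | [&& u.2 \in D, I u.1 u.2 & u.1 != p]]| = #|D| * s.
Proof.
move=> pD; rewrite cardsE -sum1_card.
transitivity (\sum_(M in D) \sum_(r | I r M && (r != p)) 1).
  rewrite pair_big_dep /= (reindex (fun u : P * L => (u.2, u.1))) //=.
  by exists (fun u => (u.2, u.1)) => -[].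
rewrite -sum_nat_const; apply: eq_bigr => M /pD pM.
have := cardsD1 p [set q | I q M].
rewrite inE pM (gq_line_degree hGQ) add1n => -[->].
by rewrite sum1dep_card; apply: eq_card => r; rewrite !inE andbC.
Qed.

(** * Counting the lines of a perfect code *)

Section PerfectCode.

(** [A] and [B] are the code points and code lines: the first three hypotheses exclude distances 1
    and 2, the last two express covering radius at most 1. *)
Variables (A : {set P}) (B : {set L}).
Hypotheses
  (AB : forall p l, p \in A -> l \in B -> ~~ I p l)
  (AA : forall p q M, p \in A -> q \in A -> I p M -> I q M -> p = q)
  (BB : forall l m q, l \in B -> m \in B -> I q l -> I q m -> l = m)
  (coverP : forall p, p \notin A -> exists2 l, l \in B & I p l)
  (coverL : forall l, l \notin B -> exists2 p, p \in A & I p l).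

Lemma code_lines_lower_bound p : p \in A -> t.+1 * s <= #|B|.
Proof.
move=> pA; have [f fP] := gq_projection_fun p.
rewrite -(gq_point_degree hGQ p) -(card_flags_off (p := p)) => [|M]; last first.
  by rewrite inE.
(* It suffices that every flag off [p] is the projection of some code line. *)
apply: leq_trans (leq_imset_card f B); apply: subset_leq_card.
apply/subsetP => -[r M]; rewrite !inE /= => /and3P[pM rM rp].
have rA: r \notin A.
  by apply: contraNN rp => rA; rewrite (AA rA pA rM pM).
have [l lB rl] := coverP rA; have [_ _ _ fl] := fP l (AB pA lB).
by apply/imsetP; exists l => //; rewrite (fl r M).
Qed.

Lemma code_lines_upper_bound l : l \in B -> #|B| <= t * s.
Proof.
move=> lB; have [q ql] := gq_point_at l.
have [f fP] := gq_projection_fun q.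
have qm m : m \in B :\ l -> ~~ I q m.
  rewrite !inE => /andP[ml mB]; apply: contraNN ml => qm.
  by rewrite (BB mB lB qm ql).
pose D := [set M | I q M] :\ l.
have cardD: #|D| = t.
  have := cardsD1 l [set M | I q M].
  by rewrite inE ql (gq_point_degree hGQ) add1n => -[<-].
pose F := [set u : P * L | [&& u.2 \in D, I u.1 u.2 & u.1 != q]].
have cardF: #|F| = t * s.
  by rewrite card_flags_off ?cardD // => M; rewrite !inE => /andP[].
(* A second line through [q] meets [l], so it is not in [B] and carries a code point [r0]; the flag
   [(r0, M0)] is not the projection of a code line. *)
have [M0 qM0 M0l] := gq_second_line ql.
have M0B: M0 \notin B by apply: contraNN M0l => M0B; rewrite (BB M0B lB qM0 ql).
have [r0 r0A r0M0] := coverL M0B.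
have u0F: (r0, M0) \in F.
  rewrite !inE /= M0l qM0 r0M0 /=.
  by apply: contraTneq r0A => ->; apply: contraL ql => /AB; apply.
have f_inj: {in B :\ l &, injective f}.
  move=> m m' mBl m'Bl fmm'; have [_ _ fm _] := fP m (qm m mBl).
  have [_ _ fm' _] := fP m' (qm m' m'Bl); rewrite -fmm' in fm'.
  by move: mBl m'Bl; rewrite !inE => /andP[_ mB] /andP[_ m'B]; apply: BB fm fm'.
(* Removing [l] from [B] and [(r0, M0)] from [F] cancels 1 on both sides; [f] injects what is
   left. *)
rewrite (cardsD1 l B) lB -cardF (cardsD1 (r0, M0) F) u0F leq_add2l.
rewrite -(card_in_imset f_inj); apply: subset_leq_card.
apply/subsetP => _ /imsetP[m mBl ->]; have [qfm ffm fm _] := fP m (qm m mBl).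
move: (qm m mBl) (mBl); rewrite !inE => nqm /andP[ml mB].
rewrite qfm ffm andbT /=; apply/and3P; split.
- by apply: contraTneq fm => ->; apply: AB.
- by apply: contraNneq ml => fml; rewrite fml in ffm; rewrite (BB mB lB fm ffm).
- by apply: contraNneq nqm => <-.
Qed.

(** A code line yields a code point, so both bounds apply and give [t.+1 * s <= t * s]. *)
Lemma no_code_line l : l \notin B.
Proof.
apply/negP => lB; have [q ql] := gq_point_at l.
have [M qM Ml] := gq_second_line ql.
have MB: M \notin B by apply: contraNN Ml => MB; rewrite (BB MB lB qM ql).
have [p pA _] := coverL MB.
have := leq_trans (code_lines_lower_bound pA) (code_lines_upper_bound lB).
by have := gq_s_gt0 hGQ; lia.
Qed.

Lemma no_code_point p : p \notin A.
Proof.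
apply/negP => pA; have [M pM] := gq_line_at p.
have [q qM qp] := gq_second_point pM.
have qA: q \notin A by apply: contraNN qp => qA; rewrite (AA qA pA qM pM).
by have [l lB _] := coverP qA; have := no_code_line l; rewrite lB.
Qed.

End PerfectCode.

Lemma perfect_code_trivial (C : {set (P + L)%type}) :
  perfect_code (incidence_graph I) C -> trivial_code C.
Proof.
move=> perfC; apply: contraT => nontrivC.
have [/set0Pn[x xC] far cover] :=
  perfect_code_diam4 incidence_gdist_le4 nontrivC perfC.
(* Codewords joined by a walk of length at most 2 coincide; explicit short walks then give [AB],
   [AA] and [BB]. *)
have near w y z : path (incidence_graph I) y w -> size w <= 2 -> last y w = z ->
    y \in C -> z \in C -> y = z.
  move=> yw w2 <- yC zC; apply/eqP; apply: contraT => yz.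
  have := leq_trans (far _ _ yC zC yz) (gdist_le_path yw).
  by rewrite ltnNge w2.
pose A := [set p | inl p \in C]; pose B := [set l | inr l \in C].
have AB p l : p \in A -> l \in B -> ~~ I p l.
  rewrite !inE => pC lC; apply/negP => pl.
  suff: inl p = inr l :> P + L by [].
  by apply: (near [:: inr l]); rewrite //= pl.
have AA p q M : p \in A -> q \in A -> I p M -> I q M -> p = q.
  rewrite !inE => pC qC pM qM.
  suff [->]: inl p = inl q :> P + L by [].
  by apply: (near [:: inr M; inl q]); rewrite //= pM qM.
have BB l m q : l \in B -> m \in B -> I q l -> I q m -> l = m.
  rewrite !inE => lC mC ql qm.
  suff [->]: inr l = inr m :> P + L by [].
  by apply: (near [:: inl q; inr m]); rewrite //= ql qm.
have coverP p : p \notin A -> exists2 l, l \in B & I p l.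
  by rewrite inE => /cover[[//|l] lC pl]; exists l; rewrite ?inE.
have coverL l : l \notin B -> exists2 p, p \in A & I p l.
  by rewrite inE => /cover[[p|//] pC pl]; exists p; rewrite ?inE.
case: x xC => [p|l] xC.
  by have := no_code_point AB AA BB coverP coverL p; rewrite inE xC.
by have := no_code_line AB AA BB coverP coverL l; rewrite inE xC.
Qed.

End GenQuadrangle.

Theorem theorem3p2 (P L : finType) (s t : nat) (I : P -> L -> bool)
    (hGQ : gen_quadrangle s t I) :
  ~ exists C : {set (P + L)%type},
      [/\ ~~ trivial_code C,
          perfect_code (incidence_graph I) C
        & exists G : {group {perm (P + L)%type}},
            G \subset code_aut (incidence_graph I) C
            /\ [transitive G, on C | 'P]].
Proof.
by case=> C [nontrivC /(perfect_code_trivial hGQ) trivC _]; rewrite trivC in nontrivC.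
Qed.
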